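(* Let $k\ge 6$ and $n\ge 2k-2$, and let $G\in\mathfrak{Gr}(n,k)$. Then $G$ contains a triangle.
   Context: All graphs are finite, simple and undirected. For a graph $G=(V,E)$ and $x\in V$, $N[x]=\{x\}\cup\{y: xy\in E\}$. A set $C\subseteq V$ is identifying if $N[x]\cap C\ne\emptyset$ for every $x\in V$ and $N[x]\cap C\neq N[y]\cap C$ for all distinct $x,y\in V$. For $n\ge k\ge1$, $\mathfrak{Gr}(n,k)$ is the set of graphs on $n$ vertices in which every $k$-element subset of vertices is identifying. *)

(* Defs.v *)
From mathcomp Require Import all_boot.

Set Implicit Arguments.
Unset Strict Implicit.
Unset Printing Implicit Defensive.

Record sgraph (V : finType) := SGraph {
  adj :> rel V;
  adj_sym : symmetric adj;
  adj_irrefl : irreflexive adj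
}.

Definition closed_nbhd (V : finType) (G : sgraph V) (x : V) : {set V} :=
  x |: [set y | G x y].

Notation "N[ G ; x ]" := (closed_nbhd G x) (format "N[ G ;  x ]").

Definition identifying (V : finType) (G : sgraph V) (C : {set V}) : Prop :=
  (forall x : V, N[G; x] :&: C != set0) /\
  (forall x y : V, x != y -> N[G; x] :&: C != N[G; y] :&: C).

(* G belongs to Gr(n, k), which is meant for 1 <= k <= n; for k > n the second
   clause would be vacuous. *)
Definition Gr (n k : nat) (V : finType) (G : sgraph V) : Prop :=
  #|V| = n /\ (forall C : {set V}, #|C| = k -> identifying G C).

(* The three vertices are automatically distinct, as adjacency is irreflexive. *)
Definition has_triangle (V : finType) (G : sgraph V) : Prop :=
  exists x y z : V, [/\ G x y, G y z & G x z].

(* Main.v *)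
Require Import Defs.
From mathcomp Require Import all_boot.
From mathcomp Require Import zify.

(** A k-set can be chosen to avoid any set of at most n - k vertices, so with
   t = n - k + 1 >= n / 2 all closed neighbourhoods and all their pairwise
   symmetric differences have at least t elements.  If G has no triangle, two
   neighbours y, y' of x have all their neighbours outside N(x), a set of size at
   most n - t + 1, so N(y) and N(y') overlap too much unless k = 6, n = 10 or
   k = 7, n = 12.  In these cases every degree is t - 1 and
   N(y) :|: N(y') is exactly the complement of N(x), so each vertex outside N(x)
   misses at most one neighbour of x; counting the non-adjacent pairs between
   N(x) and its complement gives a contradiction. *)

(** Otherwise the complement of [S] would contain a [k]-set, which misses [S]. *)
Lemma card_hitting_set (V : finType) (S : {set V}) (k : nat) :
  (forall C : {set V}, #|C| = k -> S :&: C != set0) -> #|V| < #|S| + k.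
Proof.
move=> hit; rewrite ltnNge; apply/negP => le_V.
have kS : k <= #|~: S| by have := cardsC S; lia.
have [C [uC sz sC]] := card_geqP kS.
have cC : #|[set x in C]| = k by rewrite cardsE -sz; apply/card_uniqP.
have /set0Pn[x] := hit _ cC.
by rewrite !inE => /andP[xS /sC]; rewrite inE xS.
Qed.

Section TriangleFree.
Variables (k n : nat) (V : finType) (G : sgraph V).
Hypothesis hG : Gr n k G.

Let nbhd x := [set y | G x y].

Lemma Gr_degree x : n <= #|nbhd x| + k.
Proof.
case: hG => <- identC.
have := @card_hitting_set V N[G; x] k (fun C cC => (identC C cC).1 x).
by rewrite /closed_nbhd cardsU1 inE adj_irrefl add1n addSn ltnS.
Qed.

(** The symmetric difference of the closed neighbourhoods meets every [k]-set. It exceeds that of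
    the open ones by at most [x] and [y], whence the 2. *)
Lemma Gr_codegree x y : x != y ->
  n + 2 * #|nbhd x :&: nbhd y| < 2 + #|nbhd x| + #|nbhd y| + k.
Proof.
case: hG => <- identC xy.
pose D := (N[G; x] :\: N[G; y]) :|: (N[G; y] :\: N[G; x]).
have hitD (C : {set V}) : #|C| = k -> D :&: C != set0.
  move=> /identC [_ /(_ x y xy)]; apply: contra => /eqP D0.
  apply/eqP/setP => z; move/setP/(_ z): D0; rewrite /D /closed_nbhd !inE.
  by case: (z \in C); case: ((z == x) || _); case: ((z == y) || _).
have sD : D \subset [set x; y] :|: ((nbhd x :\: nbhd y) :|: (nbhd y :\: nbhd x)).
  apply/subsetP => z; rewrite /D /closed_nbhd !inE.
  by case: (z == x); case: (z == y); case: (G x z); case: (G y z).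
have := card_hitting_set _ _ _ hitD; have := subset_leq_card sD.
have := (leq_card_setU [set x; y] ((nbhd x :\: nbhd y) :|: (nbhd y :\: nbhd x))).1.
have := (leq_card_setU (nbhd x :\: nbhd y) (nbhd y :\: nbhd x)).1.
have := cardsID (nbhd y) (nbhd x); have := cardsID (nbhd x) (nbhd y).
by rewrite (setIC (nbhd y)) cards2 xy /=; lia.
Qed.

Hypothesis triangle_free : ~ has_triangle G.

Lemma nbhdU_sub x y y' : G x y -> G x y' ->
  nbhd y :|: nbhd y' \subset ~: nbhd x.
Proof.
move=> xy xy'; apply/subsetP => z; rewrite !inE => yz; apply/negP => xz.
by case/orP: yz => yz; apply: triangle_free; [exists x, y, z | exists x, y', z].
Qed.

Lemma nbhdU_card x y y' : G x y -> G x y' ->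
  #|nbhd y| + #|nbhd y'| + #|nbhd x| <= n + #|nbhd y :&: nbhd y'|.
Proof.
move=> xy xy'; have := subset_leq_card (nbhdU_sub _ _ _ xy xy').
have := cardsC (nbhd x); have := cardsUI (nbhd y) (nbhd y').
by rewrite hG.1; lia.
Qed.

Hypotheses (hk : 6 <= k) (hn : 2 * k - 2 <= n).

Lemma triangle_free_regular x :
  #|nbhd x| + k = n /\ (k = 6 /\ n = 10 \/ k = 7 /\ n = 12).
Proof.
have degx := Gr_degree x.
have /card_gt1P[y [y' [xy xy' yy']]] : 1 < #|nbhd x| by lia.
(* Eliminating the number of common neighbours of [y] and [y'] gives deg y + deg y' + 2 deg x <= n +
   k + 1. All degrees are at least n - k, so 3n <= 5k + 1, hence k <= 7; the slack left is at most
   1, too little for deg x to exceed n - k. *)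
have := Gr_codegree _ _ yy'; have := Gr_degree y; have := Gr_degree y'.
by rewrite !inE in xy xy'; have := nbhdU_card _ _ _ xy xy'; lia.
Qed.

(** Now [y] and [y'] have at most 2 (k = 6) or 3 (k = 7) common neighbours, so the union has at
    least 6 or 7 elements, the size of the complement. *)
Lemma nbhdU_eq x y y' : G x y -> G x y' -> y != y' ->
  nbhd y :|: nbhd y' = ~: nbhd x.
Proof.
move=> xy xy' yy'; apply/eqP; rewrite eqEcard nbhdU_sub //=.
have := triangle_free_regular x; have := triangle_free_regular y.
have := triangle_free_regular y'; have := Gr_codegree _ _ yy'.
have := cardsC (nbhd x); have := cardsUI (nbhd y) (nbhd y').
by rewrite hG.1; lia.
Qed.

Lemma triangle_free_absurd : False.
Proof.
have /card_gt0P[x _] : 0 < #|V| by rewrite hG.1; lia.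
have [degx sizes] := triangle_free_regular x.
(* The 2 is n - 2 deg: 10 - 8 or 12 - 10. *)
have missed y : y \in nbhd x -> \sum_(w in ~: nbhd x) ~~ G y w = 2.
  rewrite inE => xy; rewrite -big_mkcondr sum1dep_card.
  have -> : [set w | (w \in ~: nbhd x) && ~~ G y w] = ~: nbhd x :\: nbhd y.
    by apply/setP => w; rewrite !inE andbC.
  have /setIidPr sub : nbhd y \subset ~: nbhd x.
    by have := nbhdU_sub _ _ _ xy xy; rewrite setUid.
  have := cardsID (nbhd y) (~: nbhd x); rewrite sub.
  have := cardsC (nbhd x); rewrite hG.1.
  by have := triangle_free_regular y; lia.
have misses w : w \in ~: nbhd x -> \sum_(y in nbhd x) ~~ G y w <= 1.
  move=> xw; rewrite -big_mkcondr sum1dep_card.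
  apply/card_le1_eqP => y y'; rewrite !inE => /andP[xy yw] /andP[xy' yw'].
  apply/eqP/negPn/negP => yy'; move: xw.
  by rewrite -(nbhdU_eq _ _ _ xy xy') 1?eq_sym // !inE (negPf yw) (negPf yw').
have : \sum_(w in ~: nbhd x) \sum_(y in nbhd x) ~~ G y w
    <= \sum_(w in ~: nbhd x) 1 by apply: leq_sum.
(* Double counting yields 2 deg x <= n - deg x, that is 8 <= 6 or 10 <= 7. *)
rewrite exchange_big (eq_bigr _ missed) /= !sum_nat_const; have := cardsC (nbhd x); rewrite hG.1.
by lia.
Qed.

End TriangleFree.

Theorem theorem20 (k n : nat) (hk : 6 <= k) (hn : 2 * k - 2 <= n)
  (V : finType) (G : sgraph V) (hG : Gr n k G) : has_triangle G.
Proof.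
pose tri := [exists x, [exists y, [exists z, [&& G x y, G y z & G x z]]]].
have [/existsP[x /existsP[y /existsP[z /and3P tri_xyz]]]|no_tri] := boolP tri.
  by exists x, y, z.
case: (triangle_free_absurd _ _ _ _ hG _ hk hn) => -[x [y [z xyz]]].
move/negP: no_tri; apply; apply/existsP; exists x; apply/existsP; exists y.
by apply/existsP; exists z; apply/and3P.
Qed.
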